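(* Let $G$ be the graph on the $16$ vertices $u_i,b_i,o_i,r_i$ ($0\le i\le 3$) whose edge set is the union of the edge sets of the following eight complete graphs $K_4$: the complete graph on $\{u_0,u_1,u_2,u_3\}$; for each $i\in\{0,1,2,3\}$, the complete graph on $\{u_i,b_i,o_i,r_i\}$; the complete graph on $\{b_0,b_1,b_2,b_3\}$; the complete graph on $\{o_0,o_1,o_2,o_3\}$; and the complete graph on $\{r_0,r_1,r_2,r_3\}$. Then $G$ contains no copy of $\widehat P_4$ and $G$ has exactly $32=\lfloor 16^2/8\rfloor$ triangles; in particular $G$ is an extremal graph for $\mathrm{ex}(16,K_3,\widehat P_4)$ that contains a $K_4$.
   Context: All graphs are finite and simple. $P_4$ denotes the path on $4$ vertices. For a graph $G$, its suspension $\widehat G$ is the graph obtained from $G$ by adding one new vertex and joining it to every vertex of $G$. ''Contains a copy of $H$'' means contains a subgraph (not necessarily induced) isomorphic to $H$. $\mathrm{ex}(n,K_3,H)$ denotes the maximum number of triangles in an $n$-vertex graph containing no copy of $H$. *)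

(* Defs.v *)
From mathcomp Require Import all_boot.
Set Implicit Arguments. Unset Strict Implicit. Unset Printing Implicit Defensive.

(* A finite simple graph is a finType of vertices with an edge relation
   (all relations used below are symmetric and irreflexive). *)

Definition contains_copy (T U : finType) (eG : rel T) (eH : rel U) : Prop :=
  exists f : U -> T, injective f /\ forall x y, eH x y -> eG (f x) (f y).

Definition path_graph (n : nat) : rel 'I_n :=
  fun x y => (x.+1 == y :> nat) || (y.+1 == x :> nat).

Definition complete_graph (n : nat) : rel 'I_n := fun x y => x != y.

Definition suspension (n : nat) (e : rel 'I_n) : rel 'I_n.+1 :=
  fun x y =>
    match unlift ord_max x, unlift ord_max y with
    | Some a, Some b => e a b
    | Some _, None | None, Some _ => true
    | None, None => false
    end.

Definition triangles (T : finType) (e : rel T) : nat :=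
  #|[set S : {set T} | (#|S| == 3) &&
       [forall x in S, forall y in S, (x != y) ==> e x y]]|.

(* The 16-vertex graph: vertex (c, i) with c : 'I_4 the letter
   (0 = u, 1 = b, 2 = o, 3 = r) and i : 'I_4 the index. *)
Notation V16 := ('I_4 * 'I_4)%type.
Definition vu (i : 'I_4) : V16 := (inord 0, i).
Definition vb (i : 'I_4) : V16 := (inord 1, i).
Definition vo (i : 'I_4) : V16 := (inord 2, i).
Definition vr (i : 'I_4) : V16 := (inord 3, i).

Definition cliques16 : seq {set V16} :=
  [:: [set vu i | i : 'I_4];
      [set vu (inord 0); vb (inord 0); vo (inord 0); vr (inord 0)];
      [set vu (inord 1); vb (inord 1); vo (inord 1); vr (inord 1)];
      [set vu (inord 2); vb (inord 2); vo (inord 2); vr (inord 2)];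
      [set vu (inord 3); vb (inord 3); vo (inord 3); vr (inord 3)];
      [set vb i | i : 'I_4];
      [set vo i | i : 'I_4];
      [set vr i | i : 'I_4]].

Definition G16 : rel V16 :=
  fun x y => (x != y) && has (fun K : {set V16} => (x \in K) && (y \in K)) cliques16.

Arguments path_graph n : clear implicits.
Arguments complete_graph n : clear implicits.

(* Main.v *)
Require Import Defs.
From mathcomp Require Import all_boot.
From Stdlib Require Import FunctionalExtensionality.

Set Implicit Arguments. Unset Strict Implicit. Unset Printing Implicit Defensive.

(* The graph G16 is the rook's graph K_4 x K_4: writing its vertices as
   pairs (letter, index), two vertices are adjacent iff they agree in one
   coordinate, i.e. iff they lie on a common "line" (a row or a column).
   Two distinct lines meet in at most one vertex, and every triangle lies
   on a line.  Hence the triangles are exactly the 3-subsets of lines,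
   which gives #|T1| * C(#|T2|,3) + #|T2| * C(#|T1|,3) triangles (32 for
   4 x 4).  In a copy of the suspension of P_k, the apex w and consecutive
   path vertices form triangles, whose lines all share the two points w and
   the common path vertex; so the whole copy lies on one line, which is
   impossible once lines have at most k vertices.  Finally a line is a
   clique, giving the K_4. *)

Section RookGraph.
Variables T1 T2 : finType.

Definition rook : rel (T1 * T2) :=
  fun x y => (x != y) && ((x.1 == y.1) || (x.2 == y.2)).

Definition line (l : T1 + T2) : {set T1 * T2} :=
  [set x | match l with inl a => x.1 == a | inr b => x.2 == b end].

Lemma card_line (l : T1 + T2) :
  #|line l| = match l with inl _ => #|T2| | inr _ => #|T1| end.
Proof.
case: l => [a|b].
- have -> : line (inl a) = [set (a, y) | y : T2].
    apply/setP => -[x y]; rewrite !inE; apply/eqP/imsetP => [/= ->|[z _ [-> _]]] //.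
    by exists y.
  by rewrite card_imset // => y z [].
- have -> : line (inr b) = [set (x, b) | x : T1].
    apply/setP => -[x y]; rewrite !inE; apply/eqP/imsetP => [/= ->|[z _ [_ ->]]] //.
    by exists x.
  by rewrite card_imset // => y z [].
Qed.

Lemma rook_line_clique (l : T1 + T2) (x y : T1 * T2) :
  x \in line l -> y \in line l -> x != y -> rook x y.
Proof.
by case: l => t; rewrite !inE /rook => /eqP-> /eqP-> ->; rewrite eqxx ?orbT.
Qed.

Lemma rook_edge_line (x y : T1 * T2) :
  rook x y -> exists l, x \in line l /\ y \in line l.
Proof.
case/andP=> _ /orP[e|e]; [exists (inl x.1) | exists (inr x.2)];
  by rewrite !inE eqxx eq_sym.
Qed.

Lemma line_unique (l l' : T1 + T2) (x y : T1 * T2) : x != y ->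
  x \in line l -> y \in line l -> x \in line l' -> y \in line l' -> l = l'.
Proof.
case: x y => [x1 x2] [y1 y2] ne.
case: l l' => [a|b] [a'|b']; rewrite !inE /= => /eqP ex /eqP ey /eqP ex' /eqP ey';
  by [congr inl; rewrite -ex -ex' | rewrite ex ey ex' ey' eqxx in ne
     | congr inr; rewrite -ex -ex'].
Qed.

(* Every triangle lies on a line: there are no edges between the row-mates
   and the column-mates of a vertex. *)
Lemma rook_triangle_line (a b c : T1 * T2) :
  rook a b -> rook b c -> rook a c ->
  exists l, [/\ a \in line l, b \in line l & c \in line l].
Proof.
move=> ab bc ac; have [l [al bl]] := rook_edge_line ab; exists l; split=> //.
move: ab bc ac al bl; case: a b c => [a1 a2] [b1 b2] [c1 c2].
case: l => t; rewrite /rook !inE !xpair_eqE /= => /andP[ne _] /andP[_ bc] /andP[_ ac].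
all: move=> /eqP ea /eqP eb; subst; case: eqVneq => // ct; rewrite eqxx /= in ne.
- move: ac bc; rewrite ![_ == c1]eq_sym (negbTE ct) /= => /eqP eac /eqP ebc.
  by rewrite eac ebc eqxx in ne.
- move: ac bc; rewrite ![_ == c2]eq_sym (negbTE ct) !orbF => /eqP eac /eqP ebc.
  by rewrite eac ebc eqxx in ne.
Qed.

Definition line_triples (l : T1 + T2) : {set {set T1 * T2}} :=
  [set S : {set T1 * T2} | (S \subset line l) && (#|S| == 3)].

Lemma rook_triangle_sets :
  [set S : {set T1 * T2} | (#|S| == 3) &&
     [forall x in S, forall y in S, (x != y) ==> rook x y]]
  = \bigcup_l line_triples l.
Proof.
apply/setP => S; rewrite !inE; apply/andP/bigcupP => [[S3 /forall_inP cl]|].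
- have adj x y : x \in S -> y \in S -> x != y -> rook x y.
    by move=> xS yS; move/forall_inP/(_ y yS)/implyP: (cl x xS).
  have /card_gt1P[x [y [xS yS xy]]] : 1 < #|S| by rewrite (eqP S3).
  have [l [xl yl]] := rook_edge_line (adj x y xS yS xy).
  exists l => //; rewrite inE S3 andbT; apply/subsetP => z zS.
  case: (eqVneq z x) => [->|zx] //; case: (eqVneq z y) => [->|zy] //.
  rewrite eq_sym in zx; rewrite eq_sym in zy.
  have [l' [xl' yl' zl']] := rook_triangle_line (adj x y xS yS xy)
    (adj y z yS zS zy) (adj x z xS zS zx).
  by rewrite (line_unique xy xl yl xl' yl').
- case=> l _; rewrite inE => /andP[/subsetP Sl S3]; split=> //.
  apply/forall_inP => x xS; apply/forall_inP => y yS; apply/implyP.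
  exact: rook_line_clique (Sl x xS) (Sl y yS).
Qed.

Lemma line_triples_disjoint (l l' : T1 + T2) :
  l != l' -> [disjoint line_triples l & line_triples l'].
Proof.
move=> ne; rewrite -setI_eq0; apply/set0Pn => -[S]; rewrite !inE.
case/andP=> /andP[/subsetP Sl S3] /andP[/subsetP Sl' _].
have /card_gt1P[x [y [xS yS xy]]] : 1 < #|S| by rewrite (eqP S3).
by rewrite (line_unique xy (Sl x xS) (Sl y yS) (Sl' x xS) (Sl' y yS)) eqxx in ne.
Qed.

Lemma rook_triangles :
  triangles rook = #|T1| * 'C(#|T2|, 3) + #|T2| * 'C(#|T1|, 3).
Proof.
rewrite /triangles rook_triangle_sets -sum1_card.
rewrite (partition_disjoint_bigcup _ _ line_triples_disjoint).
under eq_bigr => l _ do rewrite sum1_card cards_draws card_line.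
by rewrite big_sumType /= !sum_nat_const.
Qed.

(* If all lines have at most k vertices, the rook's graph contains no
   suspension of P_k: a copy would lie on a single line (k + 1 vertices). *)
Lemma rook_no_suspended_path (n : nat) : #|T1| <= n.+1 -> #|T2| <= n.+1 ->
  ~ contains_copy rook (suspension (path_graph n.+1)).
Proof.
move=> T1n T2n [f [injf homf]].
pose w := f ord_max; pose p (j : nat) := f (lift ord_max (inord j)).
have w_p j : rook w (p j) by apply: homf; rewrite /suspension unlift_none liftK.
have p_p j : j < n -> rook (p j) (p j.+1).
  move=> jn; apply: homf; rewrite /suspension !liftK /path_graph !inordK ?eqxx //.
  exact: ltnW.
have [l [wl p0l]] := rook_edge_line (w_p 0).
have p_line j : j <= n -> p j \in line l.
  elim: j => // j IH jn.
  have [l' [wl' pl' pSl']] := rook_triangle_line (w_p j) (p_p j jn) (w_p j.+1).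
  have /andP[w_ne_p _] := w_p j.
  by rewrite (line_unique w_ne_p wl (IH (ltnW jn)) wl' pl').
have f_line k : f k \in line l.
  case: (unliftP ord_max k) => [j ->|->] //.
  by rewrite -[j]inord_val; apply: p_line; rewrite -ltnS.
have image_in_line : [set f k | k in 'I_n.+2] \subset line l.
  by apply/subsetP => _ /imsetP[k _ ->].
have := subset_leq_card image_in_line; rewrite card_imset // card_ord card_line.
by case: (l) => _ /leq_trans; [move/(_ _ T2n) | move/(_ _ T1n)]; rewrite ltnn.
Qed.

End RookGraph.

Lemma rook_contains_complete (T : finType) (a : T) (n : nat) :
  contains_copy (@rook T 'I_n) (complete_graph n).
Proof.
exists (pair a); split=> [i j [] //|i j ij].
by apply: (@rook_line_clique _ _ (inl a)); rewrite ?inE // xpair_eqE eqxx.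
Qed.

(* G16 is the 4 x 4 rook's graph: the eight cliques are the four rows
   (fixed index) and the four columns (fixed letter). *)
Lemma G16_rook : G16 = @rook 'I_4 'I_4.
Proof.
apply: functional_extensionality => x; apply: functional_extensionality => y.
have inord4 k (lt_k4 : k < 4) : inord k = Ordinal lt_k4 :> 'I_4.
  by apply: val_inj; rewrite /= inordK.
have mem_row (c : 'I_4) (z : 'I_4 * 'I_4) :
    (z \in [set (c, i) | i : 'I_4]) = (z.1 == c).
  apply/imsetP/eqP => [[i _ ->] //|<-]; by exists z.2; last case: z.
rewrite /G16 /cliques16 /= /vu /vb /vo /vr !mem_row !inE.
rewrite !(inord4 0 isT) !(inord4 1 isT) !(inord4 2 isT) !(inord4 3 isT).
case: x => [[[|[|[|[|?]]]] ?] [[|[|[|[|?]]]] ?]] //;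
case: y => [[[|[|[|[|?]]]] ?] [[|[|[|[|?]]]] ?]] //.
Qed.

Theorem mainTheorem3 :
  ~ contains_copy G16 (suspension (path_graph 4)) /\
  triangles G16 = 32 /\ 32 = 16 ^ 2 %/ 8 /\
  contains_copy G16 (complete_graph 4).
Proof.
rewrite G16_rook; split; first by apply: rook_no_suspended_path; rewrite card_ord.
split; first by rewrite rook_triangles card_ord.
split; first by [].
exact: (rook_contains_complete (ord0 : 'I_4) 4).
Qed.
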